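(* There exist absolute constants $C_1, C_2, c>0$ and $\epsilon\in(0,1/4)$ such that for every integer $d\ge1$ there is $p_0=p_0(d)$ for which the following holds for all integers $p\ge p_0$. Put $\delta=\lceil C_1\log p\rceil$ and $m=\lceil C_2\sqrt{dp}\,\log p\rceil$. Let $\Omega\subset[p]\times[p]$ be a fixed $d$-distributed set. Let $G_1=([p],[m],E_1)$ and $G_2=([p],[m],E_2)$ be either two independent uniformly random $\delta$-left regular bipartite graphs, or $G_2=G_1$ with $G_1$ a uniformly random $\delta$-left regular bipartite graph. Then with probability exceeding $1-p^{-c}$, the tensor graph $G_1\otimes G_2$ has all of the following properties, where $N(\cdot)$ denotes neighborhoods in $G_1\otimes G_2$: 1. $|N(\Omega)|\ge p\,\delta^2(1-\epsilon)$. 2. For every $(i,i')\in([p]\times[p])\setminus\Omega$, $|N(i,i')\cap N(\Omega)|\le\epsilon\delta^2$. 3. For every $(i,i')\in\Omega$, $|N(i,i')\cap N(\Omega\setminus\{(i,i')\})|\le\epsilon\delta^2$.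
   Context: Notation: $[p]=\{1,\dots,p\}$. A set $\Omega\subset[p]\times[p]$ is $d$-distributed if (1) $(i,i)\in\Omega$ for all $i\in[p]$, and (2) for every $k\in[p]$, each of the sets $\{(i,j)\in\Omega: i=k\}$ and $\{(i,j)\in\Omega: j=k\}$ has at most $d$ elements. A uniformly random $\delta$-left regular bipartite graph $G=([p],[m],E)$ with left set $[p]$ and right set $[m]$: for each $i\in[p]$, $\delta$ vertices $j_1(i),\dots,j_\delta(i)$ are chosen independently and uniformly at random, with replacement, from $[m]$ (independently over $i$), and the edges from $i$ are $\{i,j_k(i)\}$, $k=1,\dots,\delta$. Tensor graph: $G_1\otimes G_2$ is the bipartite graph with left set $[p]\times[p]$ and right set $[m]\times[m]$ in which $(i,i')$ is joined to $(j,j')$ if and only if $\{i,j\}\in E_1$ and $\{i',j'\}\in E_2$. For a set $S\subset[p]\times[p]$ of left vertices, $N(S)\subset[m]\times[m]$ is the set of right vertices adjacent to at least one element of $S$; $N(i,i')=N(\{(i,i')\})$. *)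

(* Defs.v *)
From HB Require Import structures.
From mathcomp Require Import all_boot all_order all_algebra.
From mathcomp Require Import reals exp.

Set Implicit Arguments.
Unset Strict Implicit.
Unset Printing Implicit Defensive.

Import Order.TTheory GRing.Theory Num.Theory.
Local Open Scope ring_scope.

Definition distributed (p d : nat) (Omega : {set 'I_p * 'I_p}) : Prop :=
  (forall i : 'I_p, (i, i) \in Omega) /\
  (forall k : 'I_p, (#|[set x in Omega | x.1 == k]| <= d)%N /\
                    (#|[set x in Omega | x.2 == k]| <= d)%N).

(* A bipartite graph with left set [L] and right set [V], given by its edges,
   each listed as (left end, right end). *)
Definition bigraph (L V : finType) := {set L * V}.

Definition tensor (L1 V1 L2 V2 : finType)
    (E1 : bigraph L1 V1) (E2 : bigraph L2 V2) :
    bigraph (L1 * L2)%type (V1 * V2)%type :=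
  [set e | ((e.1.1, e.2.1) \in E1) && ((e.1.2, e.2.2) \in E2)].

Definition nbhd (L V : finType) (E : bigraph L V) (S : {set L}) : {set V} :=
  [set v | [exists x in S, (x, v) \in E]].

(* Probability of [A] under the law with mass function [mu] on a finite type. *)
Definition Pr (R : realType) (T : finType) (mu : T -> R) (A : pred T) : R :=
  \sum_(w | A w) mu w.

Definition indep_law (R : realType) (T1 T2 : finType)
    (mu1 : T1 -> R) (mu2 : T2 -> R) (w : T1 * T2) : R :=
  mu1 w.1 * mu2 w.2.

Definition uniform_law (R : realType) (T : finType) (_ : T) : R :=
  #|T|%:R^-1.

(* [j i k] is the k-th right vertex drawn by the left vertex [i]. *)
Definition choices (p delta m : nat) := {ffun 'I_p -> {ffun 'I_delta -> 'I_m}}.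

(* Independent uniform draws: the mass of an outcome is the product of the
   masses of its p * delta coordinates. *)
Definition left_regular_law (R : realType) (p delta m : nat)
    (j : choices p delta m) : R :=
  \prod_(i < p) \prod_(k < delta) uniform_law R (j i k).

(* Draws are with replacement, so repeated draws give a single edge. *)
Definition graph_of (p delta m : nat) (j : choices p delta m) :
    bigraph 'I_p 'I_m :=
  [set e | [exists k : 'I_delta, j e.1 k == e.2]].

Definition good_tensor (R : realType) (eps : R) (p delta m : nat)
    (Omega : {set 'I_p * 'I_p}) (G1 G2 : bigraph 'I_p 'I_m) : bool :=
  let N := nbhd (tensor G1 G2) in
  [&& p%:R * delta%:R ^+ 2 * (1 - eps) <= #|N Omega|%:R,
      [forall x in ~: Omega,
         #|N [set x] :&: N Omega|%:R <= eps * delta%:R ^+ 2]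
    & [forall x in Omega,
         #|N [set x] :&: N (Omega :\ x)|%:R <= eps * delta%:R ^+ 2]].

(* Main.v *)
(* Fix (i, i') and write x, y for the left vertices i of G1 and i' of G2. The
   overlap of N(i, i') with the neighborhood of the rest of Omega has two
   sources: at most 2(d + 1) left vertices meeting x or y, which collide rarely
   since m is much larger than d delta, and the elements of Omega involving
   neither x nor y. The latter cover a subset B of [m] x [m] of density at most
   d p delta^2 / m^2, a small constant, and B is independent of the draws of x
   and y. The delta^2 pairs of draws split into matchings; along a matching the
   hits of B are independent, and a union bound over the 2^delta sets of hits
   replaces a Chernoff estimate. The expansion of Omega follows by summing, over
   the diagonal, the right vertices seen by a single element of Omega. Both
   models are handled at once by embedding the left sides of G1 and G2 into one
   set L of left vertices, of size 2p or p. *)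
Require Import Defs.
From HB Require Import structures.
From mathcomp Require Import all_boot all_order all_algebra.
From mathcomp Require Import reals sequences exp.
From mathcomp Require Import zify ring lra.

Set Implicit Arguments.
Unset Strict Implicit.
Unset Printing Implicit Defensive.

Import Order.TTheory GRing.Theory Num.Theory.
Local Open Scope ring_scope.

(** * Counting form of the probability bounds: resampling one coordinate at a time *)

Section Resampling.
Local Open Scope nat_scope.

(** Here [r F w] overwrites the coordinate [g] of [F] by [w]. Exchanging that coordinate with a
    fresh value, [(F, w) |-> (r F w, g F)], is injective and leaves [Q] and [B] unchanged, so it
    sends pairs with [g F] in the target to pairs with [w] in the target. *)
Lemma card_resample (S W : finType) (r : S -> W -> S) (g : S -> W)
    (Q : pred S) (B : S -> {set W}) (b : nat) :
  (forall F w, g (r F w) = w) -> (forall F w, r (r F w) (g F) = F) ->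
  (forall F w, Q (r F w) = Q F) -> (forall F w, B (r F w) = B F) ->
  (forall F, #|B F| <= b) ->
  #|[set F | Q F && (g F \in B F)]| * #|W| <= b * #|[set F | Q F]|.
Proof.
move=> gr rr Qr Br Bb.
set A := [set F | _]; set h := fun z : S * W => (r z.1 z.2, g z.1).
have h_inj : injective h.
  move=> [F w] [F' w'] [/= E1 E2].
  have EF : F = F' by rewrite -(rr F w) E1 E2 rr.
  by congr pair => //; rewrite -(gr F w) E1 gr.
rewrite -cardsT -cardsX -(card_imset _ h_inj).
set D := [set z : S * W | Q z.1 && (z.2 \in B z.1)].
have sub : h @: setX A [set: W] \subset D.
  apply/subsetP => _ /imsetP[[F w] /setXP[+ _] ->].
  rewrite inE => /andP[QF gF].
  by rewrite inE /= Qr Br QF.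
apply: leq_trans (subset_leq_card sub) _.
have -> : #|D| = \sum_(F | Q F) #|B F|.
  rewrite -sum1_card (eq_bigr (fun F => \sum_(w | w \in B F) 1)) => [|F _].
    by rewrite pair_big_dep /=; apply: eq_bigl => z; rewrite inE.
  by rewrite sum1_card.
rewrite mulnC -sum_nat_const [leqRHS](eq_bigl Q) => [|F]; last by rewrite inE.
exact: leq_sum.
Qed.

Lemma card_bigcup_bound (I S : finType) (P : pred I) (A : I -> {set S}) (c n : nat) :
  (forall i, P i -> c * #|A i| <= n) -> c * #|\bigcup_(i | P i) A i| <= #|P| * n.
Proof.
move=> An; rewrite -sum_nat_const; elim/big_rec2: _ => [|i x U Pi IH].
  by rewrite cards0 muln0.
apply: leq_trans (leq_mul (leqnn c) (leq_card_setU _ _)) _.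
by rewrite mulnDr leq_add ?An.
Qed.

(* The k-th target may depend on the earlier draws: the draw of largest index is
   resampled first. *)
Lemma card_all_hits (S W : finType) (delta : nat) (K : {set 'I_delta})
    (r : 'I_delta -> S -> W -> S) (g : 'I_delta -> S -> W)
    (B : 'I_delta -> S -> {set W}) (b : nat) :
  {in K, forall k F w, g k (r k F w) = w} ->
  {in K, forall k F w, r k (r k F w) (g k F) = F} ->
  {in K &, forall k l : 'I_delta, l < k -> forall F w, g l (r k F w) = g l F} ->
  {in K &, forall k l : 'I_delta, l <= k -> forall F w, B l (r k F w) = B l F} ->
  {in K, forall k F, #|B k F| <= b} ->
  forall T : {set 'I_delta}, T \subset K ->
  #|[set F | [forall k in T, g k F \in B k F]]| * #|W| ^ #|T|
    <= b ^ #|T| * #|S|.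
Proof.
move=> gr rr grl Brl Bb T; move: {2}#|T| (erefl #|T|) => n.
elim: n T => [|n IHn] T cT TK.
  by rewrite cT !expn0 muln1 mul1n max_card.
have [k0 k0T] : exists k0, k0 \in T by apply/set0Pn; rewrite -card_gt0 cT.
case: (@arg_maxnP _ k0 (mem T) (fun k : 'I_delta => k : nat) k0T) => k kT' kmax.
have kT : k \in T by [].
have kK : k \in K by apply: (subsetP TK).
have T'K : T :\ k \subset K by apply: subset_trans (subsetDl _ _) TK.
have cT' : #|T :\ k| = n by move: (cardsD1 k T); rewrite cT kT => -[].
have lt l : l \in T :\ k -> l < k.
  rewrite !inE => /andP[lk lT]; rewrite ltn_neqAle; apply/andP; split.
    by apply: contra lk => /eqP /val_inj ->.
  exact: kmax.
have := @card_resample S W (r k) (g k)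
  (fun F => [forall l in T :\ k, g l F \in B l F]) (B k) b.
move=> /(_ (gr k kK) (rr k kK)) step.
have {}step := step _ (fun F w => Brl k k kK kK (leqnn k) F w) (Bb k kK).
have inv F w : [forall l in T :\ k, g l (r k F w) \in B l (r k F w)]
             = [forall l in T :\ k, g l F \in B l F].
  apply: eq_forallb => l; case: (boolP (l \in T :\ k)) => //= lT.
  have lK := subsetP T'K _ lT.
  by rewrite grl ?Brl ?lt // ltnW ?lt.
have {inv}step := step inv.
have -> : [set F | [forall k1 in T, g k1 F \in B k1 F]] =
   [set F | [forall l in T :\ k, g l F \in B l F] && (g k F \in B k F)].
  apply/setP => F; rewrite !inE; apply/forall_inP/andP => [H|[/forall_inP H Hk] l lT].
    split; last exact: H.
    by apply/forall_inP => l; rewrite !inE => /andP[_ lT]; apply: H.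
  by case: (eqVneq l k) => [->//|lk]; apply: H; rewrite !inE lk.
rewrite cT !expnS mulnA; apply: leq_trans (leq_mul step (leqnn _)) _.
by rewrite -!mulnA leq_mul2l -{1}cT' -[in X in _ <= X]cT' IHn ?orbT.
Qed.

(* Union bound over the 2 ^ delta possible sets of hits. *)
Lemma card_many_hits (S W : finType) (delta kappa : nat) (K : {set 'I_delta})
    (r : 'I_delta -> S -> W -> S) (g : 'I_delta -> S -> W)
    (B : 'I_delta -> S -> {set W}) (b : nat) :
  {in K, forall k F w, g k (r k F w) = w} ->
  {in K, forall k F w, r k (r k F w) (g k F) = F} ->
  {in K &, forall k l : 'I_delta, l < k -> forall F w, g l (r k F w) = g l F} ->
  {in K &, forall k l : 'I_delta, l <= k -> forall F w, B l (r k F w) = B l F} ->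
  {in K, forall k F, #|B k F| <= b} ->
  0 < #|W| -> b * 8 ^ kappa <= #|W| ->
  4 ^ delta *
    #|[set F | delta <= kappa * #|[set k in K | g k F \in B k F]|]| <= #|S|.
Proof.
move=> gr rr grl Brl Bb W0 bW.
set bad := [set F | _].
pose C (T : {set 'I_delta}) := [set F | [forall k in T, g k F \in B k F]].
pose P (T : {set 'I_delta}) := (T \subset K) && (delta <= kappa * #|T|).
have CT T : P T -> 8 ^ delta * #|C T| <= #|S|.
  case/andP=> TK dT; have := card_all_hits gr rr grl Brl Bb TK => H.
  rewrite -(leq_pmul2r (_ : 0 < #|W| ^ #|T|)) ?expn_gt0 ?W0 // -mulnA.
  apply: leq_trans (leq_mul (leqnn _) H) _.
  rewrite mulnA [#|S| * _]mulnC leq_mul2r; apply/orP; right.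
  (* Since [delta <= kappa * #|T|], the factor [8 ^ delta] is at most [(8 ^ kappa) ^ #|T|], and each
     [b * 8 ^ kappa] is at most [#|W|]. *)
  apply: leq_trans (leq_mul (leq_pexp2l (isT : 0 < 8) dT) (leqnn _)) _.
  rewrite expnM -expnMn; case: (posnP #|T|) => [->|T0] //.
  by rewrite leq_exp2r // mulnC.
have badsub : bad \subset \bigcup_(T | P T) C T.
  apply/subsetP => F; rewrite inE => dF; apply/bigcupP.
  exists [set k in K | g k F \in B k F].
    by rewrite /P dF andbT; apply/subsetP => k; rewrite inE => /andP[].
  by rewrite inE; apply/forall_inP => k; rewrite inE => /andP[].
have : 8 ^ delta * #|bad| <= 2 ^ delta * #|S|.
  apply: leq_trans (leq_mul (leqnn _) (subset_leq_card badsub)) _.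
  apply: leq_trans (card_bigcup_bound CT) _; rewrite leq_mul2r; apply/orP; right.
  by rewrite (leq_trans (max_card _)) // -cardsT -powersetT card_powerset cardsT card_ord.
(* The number [2 ^ delta] of sets [T] uses up part of [8 ^ delta] and leaves [4 ^ delta]. *)
by rewrite -[8]/(2 * 4) expnMn -mulnA leq_pmul2l // expn_gt0.
Qed.

End Resampling.

(** * Tables of draws and the three kinds of hits *)

Section RandomDraws.
Local Open Scope nat_scope.

Definition upd (X V : finType) (F : {ffun X -> V}) (x : X) (v : V) : {ffun X -> V} :=
  [ffun z => if z == x then v else F z].

Lemma upd_same (X V : finType) (F : {ffun X -> V}) (x : X) (v : V) : upd F x v x = v.
Proof. by rewrite ffunE eqxx. Qed.

Lemma upd_other (X V : finType) (F : {ffun X -> V}) (x z : X) (v : V) :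
  z != x -> upd F x v z = F z.
Proof. by rewrite ffunE => /negPf->. Qed.

Lemma upd_back (X V : finType) (F : {ffun X -> V}) (x : X) (v : V) :
  upd (upd F x v) x (F x) = F.
Proof. by apply/ffunP => z; rewrite !ffunE; case: eqP => [->|]. Qed.

Lemma upd_comm (X V : finType) (F : {ffun X -> V}) (x y : X) (v w : V) :
  x != y -> upd (upd F x v) y w = upd (upd F y w) x v.
Proof.
move=> xy; apply/ffunP => z; rewrite !ffunE.
by case: (eqVneq z y) => // ->; rewrite eq_sym (negPf xy).
Qed.

Variables (L : finType) (delta m : nat).
Local Notation draws := {ffun L * 'I_delta -> 'I_m}.

Definition nbr (F : draws) (x : L) : {set 'I_m} := [set F (x, k) | k : 'I_delta].

Lemma card_nbr F x : #|nbr F x| <= delta.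
Proof. by apply: leq_trans (leq_imset_card _ _) _; rewrite card_ord. Qed.

Lemma nbr_upd F x y k v : x != y -> nbr (upd F (y, k) v) x = nbr F x.
Proof.
move=> xy; apply: eq_imset => l; rewrite upd_other //.
by apply: contra xy => /eqP[->].
Qed.

Variable kappa : nat.

(** A draw counts as a hit when it repeats the value of an earlier draw of [x]; the target is then
    the set of fewer than [delta] earlier values. Draws that are not hits have distinct values, so
    there are at least [delta - #|nbr F x|] hits. *)
Lemma card_many_repeats (x : L) : 0 < m -> delta * 8 ^ kappa <= m ->
  4 ^ delta * #|[set F : draws | delta <= kappa * (delta - #|nbr F x|)]|
    <= #|{: draws}|.
Proof.
move=> m0 dm.
have := @card_many_hits draws 'I_m delta kappa setT
  (fun k F v => upd F (x, k) v) (fun k F => F (x, k))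
  (fun k F => [set F (x, l) | l in [set l : 'I_delta | l < k]]) delta.
rewrite card_ord => /(_ _ _ _ _ _ m0 dm) H.
have ne (k l : 'I_delta) : l < k -> (x, l) != (x, k).
  by move=> lk; apply/eqP => -[E]; rewrite E ltnn in lk.
apply: leq_trans (H _ _ _ _ _).
- rewrite leq_mul2l subset_leq_card ?orbT //; apply/subsetP => F; rewrite !inE.
  move/leq_trans; apply; rewrite leq_mul2l leq_subLR; apply/orP; right.
  set T := [set k in _ | _].
  have TC : #|~: T| <= #|nbr F x|.
    rewrite -(@card_in_imset _ _ (fun k => F (x, k)) (~: T)); last first.
      move=> k l kT lT /= E; apply/val_inj/eqP; case: ltngtP => // lt.
        by move: lT; rewrite !inE -E (imset_f (fun i => F (x, i))) // inE.
      by move: kT; rewrite !inE E (imset_f (fun i => F (x, i))) // inE.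
    by apply/subset_leq_card/subsetP => _ /imsetP[k _ ->]; apply: imset_f.
  by rewrite -[X in X <= _](card_ord delta) -(cardsC T) addnC leq_add2r.
- by move=> k _ F w; rewrite upd_same.
- by move=> k _ F w; rewrite upd_back.
- by move=> k l _ _ lk F w; rewrite upd_other ?ne.
- move=> k l _ _ lk F w; apply: eq_in_imset => i; rewrite inE => il.
  by rewrite upd_other // ne // (leq_trans il).
- move=> k _ F; apply: leq_trans (leq_imset_card _ _) _.
  by apply: leq_trans (max_card _) _; rewrite card_ord.
Qed.

(** As [y] is outside [S], the target, of size at most [#|S| * delta], does not change when draws of
    [y] are resampled. *)
Lemma card_meet (y : L) (S : {set L}) :
  y \notin S -> 0 < m -> #|S| * delta * 8 ^ kappa <= m ->
  4 ^ delta * #|[set F : draws | delta <=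
      kappa * #|[set k | F (y, k) \in \bigcup_(u in S) nbr F u]|]|
    <= #|{: draws}|.
Proof.
move=> yS m0 dm.
have := @card_many_hits draws 'I_m delta kappa setT
  (fun k F v => upd F (y, k) v) (fun k F => F (y, k))
  (fun k F => \bigcup_(u in S) nbr F u) (#|S| * delta).
rewrite card_ord => /(_ _ _ _ _ _ m0 dm) H.
apply: leq_trans (H _ _ _ _ _).
- rewrite leq_mul2l subset_leq_card ?orbT //; apply/subsetP => F; rewrite !inE.
  move/leq_trans; apply; rewrite leq_mul2l subset_leq_card ?orbT //.
  by apply/subsetP => k; rewrite !inE.
- by move=> k _ F w; rewrite upd_same.
- by move=> k _ F w; rewrite upd_back.
- by move=> k l _ _ lk F w; rewrite upd_other // xpair_eqE eqxx /= neq_ltn lk.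
- move=> k l _ _ _ F w; apply: eq_bigr => u uS.
  by rewrite nbr_upd //; apply: contraNneq yS => <-.
- move=> k _ F; have := @card_bigcup_bound _ _ (mem S) (nbr F) 1 delta.
  by rewrite mul1n; apply=> u _; rewrite mul1n card_nbr.
Qed.

(** Because [sigma] is injective and maps [K] outside [K], distinct [k] in [K] use disjoint pairs of
    draws, even if [x = y]. Each pair can thus be resampled as one uniform point of the square. *)
Lemma card_matched_hits (x y : L) (sigma : 'I_delta -> 'I_delta)
    (K : {set 'I_delta}) (B : draws -> {set 'I_m * 'I_m}) (b : nat) :
  injective sigma -> {in K, forall k, sigma k \notin K} ->
  (forall F k v, B (upd F (x, k) v) = B F) ->
  (forall F k v, B (upd F (y, k) v) = B F) ->
  (forall F, #|B F| <= b) -> 0 < m -> b * 8 ^ kappa <= m ^ 2 ->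
  4 ^ delta * #|[set F : draws | delta <=
      kappa * #|[set k in K | (F (x, k), F (y, sigma k)) \in B F]|]|
    <= #|{: draws}|.
Proof.
move=> sinj sK Bx By Bb m0 bm.
have neq k l : k \in K -> l \in K -> (x, l) != (y, sigma k).
  by move=> kK lK; apply: contraTneq lK => -[_ ->]; apply: sK.
apply: (@card_many_hits draws ('I_m * 'I_m)%type delta kappa K
  (fun k F v => upd (upd F (x, k) v.1) (y, sigma k) v.2)
  (fun k F => (F (x, k), F (y, sigma k))) (fun _ => B) b).
- by move=> k kK F [v w]; rewrite upd_same upd_other ?neq // upd_same.
- move=> k kK F [v w] /=.
  by rewrite -(upd_comm (upd F _ _)) ?neq // !upd_back.
- move=> k l kK lK lk F w.
  have lk' : l != k by rewrite neq_ltn lk.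
  rewrite !upd_other ?neq //.
  + by rewrite eq_sym neq.
  + by rewrite xpair_eqE eqxx (inj_eq sinj).
  + by rewrite xpair_eqE eqxx.
- by move=> k l _ _ _ F w; rewrite By Bx.
- by move=> k _ F.
- by rewrite card_prod card_ord muln_gt0 m0.
- by rewrite card_prod card_ord mulnn.
Qed.

End RandomDraws.

(** * Hits among all [delta ^ 2] pairs of draws of two left vertices *)

Section TotalHits.
Local Open Scope nat_scope.

(* The pairs (k, l) are split according to s = k + l mod delta and to the sign
   of l - k: within a class the pairs (k, s - k) involve disjoint sets of
   draws, even when both components are drawn by the same left vertex. *)
Lemma card_many_total_hits (L : finType) (delta m kappa : nat) (x y : L)
    (B : {ffun L * 'I_delta -> 'I_m} -> {set 'I_m * 'I_m}) (b : nat) :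
  0 < delta ->
  (forall F k v, B (upd F (x, k) v) = B F) ->
  (forall F k v, B (upd F (y, k) v) = B F) ->
  (forall F, #|B F| <= b) -> 0 < m -> b * 8 ^ kappa <= m ^ 2 ->
  4 ^ delta * #|[set F : {ffun L * 'I_delta -> 'I_m} |
      2 * delta ^ 2 + kappa * delta <=
      kappa * #|[set kl : 'I_delta * 'I_delta | (F (x, kl.1), F (y, kl.2)) \in B F]|]|
    <= 2 * delta * #|{: {ffun L * 'I_delta -> 'I_m}}|.
Proof.
case: delta B => // n B _ Bx By Bb m0 bm.
(* Subtraction is modulo [n.+1]. The involution [sg s] exchanges the two sign classes of [s], hence
   maps each class outside itself; its fixed points lie in neither class. *)
pose sg (s k : 'I_n.+1) : 'I_n.+1 := (s - k)%R.
have sgK s : involutive (sg s) by move=> k; rewrite /sg subKr.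
pose K (i : 'I_n.+1 * bool) :=
  [set k : 'I_n.+1 | if i.2 then k < sg i.1 k else sg i.1 k < k].
pose h (F : {ffun L * 'I_n.+1 -> 'I_m}) (k l : 'I_n.+1) :=
  (F (x, k), F (y, l)) \in B F.
pose C i := [set F | n.+1 <= kappa * #|[set k in K i | h F k (sg i.1 k)]|].
have HC i : predT i -> 4 ^ n.+1 * #|C i| <= #|{: {ffun L * 'I_n.+1 -> 'I_m}}|.
  move=> _; apply: (card_matched_hits (can_inj (sgK i.1)) _ Bx By Bb m0 bm) => k.
  by rewrite !inE sgK; case: i.2 => lt; rewrite -leqNgt ltnW.
have := card_bigcup_bound HC; rewrite cardT -cardE card_prod card_bool card_ord mulnC.
rewrite [n.+1 * 2]mulnC; apply: leq_trans; rewrite [leqRHS]mulnC leq_mul2l.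
apply/orP; right; apply/subset_leq_card/subsetP => F; rewrite inE => big.
apply/bigcupP/exists_inP; apply: contraLR big; rewrite negb_exists_in.
move=> /forall_inP small; rewrite -ltnNge.
have lt i : kappa * #|[set k in K i | h F k (sg i.1 k)]| < n.+1.
  by have := small i isT; rewrite inE -ltnNge.
have cardE_sum (A : {set 'I_n.+1}) (p : pred 'I_n.+1) :
    #|[set k in A | p k]| = \sum_k ((k \in A) && p k : nat).
  by rewrite -sum1_card big_mkcond; apply: eq_bigr => k _; rewrite inE; case: (_ && _).
have tot : #|[set kl | h F kl.1 kl.2]| = \sum_s \sum_k (h F k (sg s k) : nat).
  transitivity (\sum_k \sum_l (h F k l : nat)).
    rewrite pair_bigA -sum1_card big_mkcond /=; apply: eq_bigr => -[k l] _.
    by rewrite inE; case: (h _ _ _).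
  rewrite [RHS]exchange_big; apply: eq_bigr => k _.
  by rewrite (reindex_inj (@addIr _ (- k)%R)).
(* For each [s], the two sign classes contribute at most [n] each after scaling by [kappa]; fixed
   points of [sg s] are all counted as hits. *)
have split_s s : kappa * (\sum_k (h F k (sg s k) : nat))
    <= 2 * n + kappa * \sum_k (sg s k == k : nat).
  have : \sum_k (h F k (sg s k) : nat) <=
     #|[set k in K (s, true) | h F k (sg s k)]| +
     #|[set k in K (s, false) | h F k (sg s k)]| + \sum_k (sg s k == k : nat).
    rewrite !cardE_sum -!big_split; apply: leq_sum => k _; rewrite !inE /=.
    case: (h _ _ _) => //; rewrite !andbT -(inj_eq val_inj) /=.
    by case: (ltngtP k (sg s k)).
  have := lt (s, true); have := lt (s, false) => /=; nia.
(* Each [k] is fixed for exactly one [s], namely [k + k]. *)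
have diag : \sum_s \sum_k (sg s k == k : nat) = n.+1.
  rewrite exchange_big /= -[RHS]card_ord -sum1_card; apply: eq_bigr => k _.
  rewrite (bigD1 (k + k)%R) //= big1 => [|s sk]; first by rewrite /sg addrK eqxx.
  by rewrite /sg subr_eq (negPf sk).
have -> : #|[set kl | (F (x, kl.1), F (y, kl.2)) \in B F]| =
    \sum_s \sum_k (h F k (sg s k) : nat) by rewrite -tot.
rewrite big_distrr /=; apply: leq_ltn_trans (@leq_sum _ _ _ _ _ (fun s _ => split_s s)) _.
rewrite big_split /= -[X in _ + X]big_distrr /= diag sum_nat_const card_ord; nia.
Qed.

End TotalHits.

(** * Overlaps of neighborhoods in the tensor graph, in terms of hits *)

Section Overlaps.
Local Open Scope nat_scope.
Variables (L : finType) (p delta m : nat) (i1 i2 : 'I_p -> L).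
Hypotheses (i1_inj : injective i1) (i2_inj : injective i2).
Local Notation draws := {ffun L * 'I_delta -> 'I_m}.
Implicit Types (F : draws) (Om A : {set 'I_p * 'I_p}) (z : 'I_p * 'I_p).

Definition rows (i : 'I_p -> L) F : choices p delta m := [ffun a => [ffun k => F (i a, k)]].

Definition tnbr F A : {set 'I_m * 'I_m} :=
  nbhd (tensor (graph_of (rows i1 F)) (graph_of (rows i2 F))) A.

Lemma tnbrE F A : tnbr F A = \bigcup_(z in A) setX (nbr F (i1 z.1)) (nbr F (i2 z.2)).
Proof.
have E (i : 'I_p -> L) a v : ((a, v) \in graph_of (rows i F)) = (v \in nbr F (i a)).
  rewrite inE; apply/existsP/imsetP => /= -[k].
    by move/eqP <-; exists k => //; rewrite !ffunE.
  by move=> _ ->; exists k; rewrite !ffunE.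
apply/setP => -[v w]; rewrite inE; apply/exists_inP/bigcupP => -[z zA zv]; exists z => //.
  by move: zv; rewrite inE /= !E in_setX.
by rewrite inE /= !E -in_setX.
Qed.

Lemma tnbr1 F z : tnbr F [set z] = setX (nbr F (i1 z.1)) (nbr F (i2 z.2)).
Proof. by rewrite tnbrE big_set1. Qed.

(** The vertex [i1 z.1] is added for elements [u] with [i2 u.2 = i1 z.1], which exist only if the
    images of [i1] and [i2] meet. Removing [i2 z.2] makes its draws independent of those of the set.
    [col_mates] is symmetric. *)
Definition row_mates Om z : {set L} :=
  (i1 z.1 |: [set i2 u.2 | u in Om & u.1 == z.1]) :\ i2 z.2.
Definition col_mates Om z : {set L} :=
  (i2 z.2 |: [set i1 u.1 | u in Om & u.2 == z.2]) :\ i1 z.1.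
(** All four inequalities are imposed so that the neighborhood of this set ignores the draws of both
    [i1 z.1] and [i2 z.2], also when the two graphs share their left vertices. *)
Definition far Om z : {set 'I_p * 'I_p} :=
  [set u in Om | [&& i1 u.1 != i1 z.1, i1 u.1 != i2 z.2,
                     i2 u.2 != i1 z.1 & i2 u.2 != i2 z.2]].

Definition row_meets Om z F :=
  #|[set k | F (i2 z.2, k) \in \bigcup_(u in row_mates Om z) nbr F u]|.
Definition col_meets Om z F :=
  #|[set k | F (i1 z.1, k) \in \bigcup_(u in col_mates Om z) nbr F u]|.
Definition far_hits Om z F :=
  #|[set kl : 'I_delta * 'I_delta |
      (F (i1 z.1, kl.1), F (i2 z.2, kl.2)) \in tnbr F (far Om z)]|.

(** Each common point comes from a pair [(k, l)] of draws and is covered by some [u] in [Om] other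
    than [z]. If [u] is not far, it constrains either [l] (row) or [k] (column), leaving [delta]
    choices for the other index. *)
Lemma card_overlap Om z F :
  #|tnbr F [set z] :&: tnbr F (Om :\ z)| <=
    delta * row_meets Om z F + col_meets Om z F * delta + far_hits Om z F.
Proof.
set D := _ :&: _.
pose h (kl : 'I_delta * 'I_delta) := (F (i1 z.1, kl.1), F (i2 z.2, kl.2)).
set Rw := [set k | F (i2 z.2, k) \in \bigcup_(u in row_mates Om z) nbr F u].
set Cl := [set k | F (i1 z.1, k) \in \bigcup_(u in col_mates Om z) nbr F u].
set Fr := [set kl : 'I_delta * 'I_delta | h kl \in tnbr F (far Om z)].
have sub : D \subset h @: (setX setT Rw :|: setX Cl setT :|: Fr).
  apply/subsetP => -[v w]; rewrite inE tnbr1 in_setX => /andP[/andP[]].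
  move=> /imsetP[k _ ->] /imsetP[l _ ->]; rewrite tnbrE => /bigcupP[u].
  rewrite in_setX !inE => /andP[uz uO] /andP[n1 n2].
  apply/imsetP; exists (k, l) => //; rewrite 2!in_setU !in_setX !in_setT andbT /=.
  have [e1|d1] := eqVneq (i1 u.1) (i1 z.1).
    apply/orP; left; apply/orP; left; rewrite in_set; apply/bigcupP; exists (i2 u.2) => //.
    rewrite !inE; apply/andP; split.
      apply: contra uz => /eqP/i2_inj e2.
      by rewrite -pair_eqE /pair_eq (i1_inj e1) e2 !eqxx.
    apply/orP; right; apply/imsetP; exists u => //.
    by rewrite inE uO (i1_inj e1) eqxx.
  have [e2|d2] := eqVneq (i2 u.2) (i2 z.2).
    apply/orP; left; apply/orP; right; rewrite in_set; apply/bigcupP; exists (i1 u.1) => //.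
    rewrite !inE d1; apply/orP; right; apply/imsetP; exists u => //.
    by rewrite inE uO (i2_inj e2) eqxx.
  (* The next two cases arise only when the two left sides share vertices. *)
  have [e3|d3] := eqVneq (i1 u.1) (i2 z.2).
    apply/orP; left; apply/orP; right; rewrite in_set; apply/bigcupP; exists (i1 u.1) => //.
    by rewrite !inE d1 e3 eqxx.
  have [e4|d4] := eqVneq (i2 u.2) (i1 z.1).
    apply/orP; left; apply/orP; left; rewrite in_set; apply/bigcupP; exists (i2 u.2) => //.
    by rewrite !inE d2 e4 eqxx.
  apply/orP; right; rewrite in_set /h /= tnbrE; apply/bigcupP; exists u.
    by rewrite inE uO d1 d2 d3 d4.
  by rewrite in_setX n1 n2.
apply: leq_trans (subset_leq_card sub) _; apply: leq_trans (leq_imset_card _ _) _.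
apply: leq_trans (leq_card_setU _ _) _; rewrite leq_add2r.
apply: leq_trans (leq_card_setU _ _) _.
by rewrite !cardsX cardsT card_ord.
Qed.

(** A point seen only by [z] is not seen by any other element of [Om], so these private parts are
    pairwise disjoint. *)
Lemma sum_private_leq Om A F : A \subset Om ->
  \sum_(z in A) #|tnbr F [set z] :\: tnbr F (Om :\ z)| <= #|tnbr F Om|.
Proof.
move=> /subsetP AO; pose D z := if z \in A then tnbr F [set z] :\: tnbr F (Om :\ z) else set0.
have mono (A1 A2 : {set 'I_p * 'I_p}) : A1 \subset A2 -> tnbr F A1 \subset tnbr F A2.
  by move=> s; rewrite !tnbrE; apply/bigcupsP => z zA; apply: (bigcup_sup z); apply: (subsetP s).
have disj u z : u != z -> [disjoint D u & D z].
  move=> uz; rewrite /D; case: ifP => uA; last by rewrite disjoints_subset sub0set.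
  case: ifP => zA; last by rewrite disjoint_sym disjoints_subset sub0set.
  rewrite disjoints_subset; apply/subsetP => v; rewrite in_setC !in_setD => /andP[_ vu].
  rewrite negb_and negbK; apply/orP; left.
  by apply: (subsetP (mono [set u] _ _)) vu; rewrite sub1set !inE uz AO.
have -> : \sum_(z in A) #|tnbr F [set z] :\: tnbr F (Om :\ z)| = \sum_z #|D z|.
  by rewrite big_mkcond; apply: eq_bigr => z _; rewrite /D; case: ifP => // _; rewrite cards0.
under eq_bigr do rewrite -sum1_card.
rewrite -(partition_disjoint_bigcup _ _ disj) sum1_card subset_leq_card //.
apply/bigcupsP => z _; rewrite /D; case: ifP => [zA|_]; last exact: sub0set.
by rewrite (subset_trans (subsetDl _ _)) // mono // sub1set AO.
Qed.

End Overlaps.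

(** * Good tables of draws: they are frequent, and they control overlaps and expansion *)

Section GoodDraws.
Local Open Scope nat_scope.
Variables (L : finType) (p delta m kappa : nat) (i1 i2 : 'I_p -> L).
Hypotheses (i1_inj : injective i1) (i2_inj : injective i2).
Local Notation draws := {ffun L * 'I_delta -> 'I_m}.
Implicit Types (F : draws) (Om A : {set 'I_p * 'I_p}) (z : 'I_p * 'I_p).

(** These are the complements of the events bounded above. In the last threshold, [2 * delta ^ 2]
    accounts for the [2 * delta] matchings and [kappa * delta] for the pairs left out of them. *)
Definition good_draws Om F : bool :=
  [&& [forall x, kappa * (delta - #|nbr F x|) < delta],
      [forall z, kappa * row_meets i1 i2 Om z F < delta],
      [forall z, kappa * col_meets i1 i2 Om z F < delta]
    & [forall z, kappa * far_hits i1 i2 Om z F < 2 * delta ^ 2 + kappa * delta]].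

Lemma card_distributed (d : nat) Om : distributed d Om -> #|Om| <= d * p.
Proof.
move=> [_ H]; have -> : Om = \bigcup_(k : 'I_p) [set u in Om | u.1 == k].
  apply/setP => u; apply/idP/bigcupP => [uO|[k _]]; last by rewrite inE => /andP[].
  by exists u.1; rewrite // inE uO eqxx.
have := @card_bigcup_bound _ _ predT (fun k : 'I_p => [set u in Om | u.1 == k]) 1 d.
rewrite cardT size_enum_ord mul1n mulnC; apply=> k _; rewrite mul1n.
by have [] := H k.
Qed.

Lemma card_row_mates d Om z : distributed d Om -> #|row_mates i1 i2 Om z| <= d.+1.
Proof.
move=> [_ H]; apply: leq_trans (subset_leq_card (subsetDl _ _)) _.
rewrite cardsU1 -add1n leq_add ?leq_b1 //.
apply: leq_trans (leq_imset_card _ _) _; have [+ _] := H z.1.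
by apply: leq_trans; apply/subset_leq_card/subsetP => u; rewrite !inE.
Qed.

Lemma card_col_mates d Om z : distributed d Om -> #|col_mates i1 i2 Om z| <= d.+1.
Proof.
move=> [_ H]; apply: leq_trans (subset_leq_card (subsetDl _ _)) _.
rewrite cardsU1 -add1n leq_add ?leq_b1 //.
apply: leq_trans (leq_imset_card _ _) _; have [_] := H z.2.
by apply: leq_trans; apply/subset_leq_card/subsetP => u; rewrite !inE.
Qed.

Lemma card_tnbr F A : #|tnbr i1 i2 F A| <= #|A| * delta ^ 2.
Proof.
rewrite tnbrE.
have := @card_bigcup_bound _ _ (mem A)
  (fun z => setX (nbr F (i1 z.1)) (nbr F (i2 z.2))) 1 (delta ^ 2).
rewrite mul1n; apply=> z _; rewrite mul1n cardsX -mulnn.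
by rewrite leq_mul ?card_nbr.
Qed.

Lemma tnbr_far_upd Om z F x k v : x \in [set i1 z.1; i2 z.2] ->
  tnbr i1 i2 (upd F (x, k) v) (far i1 i2 Om z) = tnbr i1 i2 F (far i1 i2 Om z).
Proof.
move=> xz; rewrite !tnbrE; apply: eq_bigr => u; rewrite inE => /and5P[_ a b c e].
by case/set2P: xz => ->; rewrite !nbr_upd.
Qed.

(** Union bound: [#|L|] events for repeats, [p ^ 2] for rows and as many for columns, and [p ^ 2]
    for far hits, each of these weighing [2 * delta]. *)
Lemma card_not_good_draws (d : nat) Om :
  distributed d Om -> 0 < m -> 0 < delta ->
  d.+1 * delta * 8 ^ kappa <= m -> d * p * delta ^ 2 * 8 ^ kappa <= m ^ 2 ->
  4 ^ delta * #|[set F | ~~ good_draws Om F]| <=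
    (#|L| + 2 * p ^ 2 + 2 * delta * p ^ 2) * #|{: draws}|.
Proof.
move=> HO m0 d0 dm bm.
pose S1 x := [set F : draws | delta <= kappa * (delta - #|nbr F x|)].
pose S2 z := [set F : draws | delta <= kappa * row_meets i1 i2 Om z F].
pose S3 z := [set F : draws | delta <= kappa * col_meets i1 i2 Om z F].
pose S4 z := [set F : draws | 2 * delta ^ 2 + kappa * delta <= kappa * far_hits i1 i2 Om z F].
have c1 : 4 ^ delta * #|\bigcup_(x | predT x) S1 x| <= #|L| * #|{: draws}|.
  apply: card_bigcup_bound => x _; apply: card_many_repeats => //.
  by apply: leq_trans dm; rewrite -mulnA leq_pmull.
have c2 : 4 ^ delta * #|\bigcup_(z | predT z) S2 z| <= p ^ 2 * #|{: draws}|.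
  rewrite -mulnn -[p in p * p]card_ord -card_prod.
  apply: card_bigcup_bound => z _; apply: card_meet => //.
    by rewrite !inE eqxx.
  by apply: leq_trans dm; rewrite !leq_mul // (card_row_mates _ HO).
have c3 : 4 ^ delta * #|\bigcup_(z | predT z) S3 z| <= p ^ 2 * #|{: draws}|.
  rewrite -mulnn -[p in p * p]card_ord -card_prod.
  apply: card_bigcup_bound => z _; apply: card_meet => //.
    by rewrite !inE eqxx.
  by apply: leq_trans dm; rewrite !leq_mul // (card_col_mates _ HO).
have c4 : 4 ^ delta * #|\bigcup_(z | predT z) S4 z| <= p ^ 2 * (2 * delta * #|{: draws}|).
  rewrite -mulnn -[p in p * p]card_ord -card_prod.
  apply: card_bigcup_bound => z _.
  apply: (card_many_total_hits d0 _ _ _ m0 bm) => [F k v|F k v|F].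
  - by rewrite tnbr_far_upd // !inE eqxx.
  - by rewrite tnbr_far_upd // !inE eqxx orbT.
  - apply: leq_trans (card_tnbr _ _) _; rewrite leq_mul2r; apply/orP; right.
    apply: leq_trans (card_distributed HO); apply/subset_leq_card/subsetP => u.
    by rewrite inE => /andP[].
apply: leq_trans (leq_mul (leqnn _) (_ : _ <= #|\bigcup_(x | predT x) S1 x| +
  #|\bigcup_(z | predT z) S2 z| + #|\bigcup_(z | predT z) S3 z| +
  #|\bigcup_(z | predT z) S4 z|)) _; last first.
  rewrite !mulnDr; move: c1 c2 c3 c4; nia.
apply: leq_trans (subset_leq_card (_ : _ \subset
   \bigcup_(x | predT x) S1 x :|: \bigcup_(z | predT z) S2 z :|:
   \bigcup_(z | predT z) S3 z :|: \bigcup_(z | predT z) S4 z)) _.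
  apply/subsetP => F; rewrite inE !negb_and !negb_forall.
  case/or4P => /existsP[z]; rewrite -leqNgt => bad; rewrite 3!in_setU.
  - by apply/orP; left; apply/orP; left; apply/orP; left; apply/bigcupP;
    exists z; rewrite ?inE.
  - by apply/orP; left; apply/orP; left; apply/orP; right; apply/bigcupP;
    exists z; rewrite ?inE.
  - by apply/orP; left; apply/orP; right; apply/bigcupP;
    exists z; rewrite ?inE.
  - by apply/orP; right; apply/bigcupP;
    exists z; rewrite ?inE.
by do 3![apply: leq_trans (leq_card_setU _ _) _; rewrite leq_add2r].
Qed.

(** The constant is 5 = 1 + 1 + 3: rows, columns, and far hits, where [kappa * delta <= delta ^ 2]
    turns the far threshold into [3 * delta ^ 2]. *)
Lemma good_overlap Om z F : kappa <= delta -> good_draws Om F ->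
  kappa * #|tnbr i1 i2 F [set z] :&: tnbr i1 i2 F (Om :\ z)| <= 5 * delta ^ 2.
Proof.
move=> kd /and4P[_ /forallP/(_ z) h2 /forallP/(_ z) h3 /forallP/(_ z) h4].
apply: leq_trans (leq_mul (leqnn _) (card_overlap i1_inj i2_inj Om z F)) _.
have : kappa * delta <= delta ^ 2 by rewrite -mulnn leq_mul.
rewrite !mulnDr [kappa * (delta * _)]mulnCA mulnA.
have := leq_mul (leqnn delta) (ltnW h2); have := leq_mul (ltnW h3) (leqnn delta).
rewrite -mulnn in h4 *; lia.
Qed.

(** The constant is 7 = 2 + 5: repeated draws in the two factors of a neighborhood cost 2, and its
    overlap with the rest costs 5. Summing private parts over the [p] diagonal elements suffices. *)
Lemma good_expansion Om F : kappa <= delta -> (forall i, (i, i) \in Om) ->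
  good_draws Om F ->
  p * delta ^ 2 * kappa <= kappa * #|tnbr i1 i2 F Om| + 7 * (p * delta ^ 2).
Proof.
move=> kd dOm good; have /and4P[/forallP h1 _ _ _] := good.
pose A := [set (i, i) | i : 'I_p].
have AO : A \subset Om by apply/subsetP => _ /imsetP[i _ ->].
have cA : #|A| = p by rewrite card_imset ?card_ord // => i j [].
have priv z : z \in A -> delta ^ 2 * kappa <=
    kappa * #|tnbr i1 i2 F [set z] :\: tnbr i1 i2 F (Om :\ z)| + 7 * delta ^ 2.
  move=> _; have := good_overlap z kd good; rewrite cardsD.
  have : #|tnbr i1 i2 F [set z] :&: tnbr i1 i2 F (Om :\ z)| <= #|tnbr i1 i2 F [set z]|.
    exact/subset_leq_card/subsetIl.
  have : delta ^ 2 * kappa <= kappa * #|tnbr i1 i2 F [set z]| + 2 * delta ^ 2.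
    rewrite tnbr1 cardsX; have := h1 (i1 z.1); have := h1 (i2 z.2).
    have := card_nbr F (i1 z.1); have := card_nbr F (i2 z.2).
    move: #|nbr F (i1 z.1)| #|nbr F (i2 z.2)| => a b.
    move=> bd ad hb ha; rewrite -mulnn.
    have -> : delta * delta = a * b + (delta - a) * b + (delta - b) * delta.
      by rewrite -mulnDl subnKC // [(_ - _) * _]mulnC -mulnDr subnKC.
    have := leq_mul (ltnW ha) bd; have := leq_mul (ltnW hb) (leqnn delta).
    by nia.
  nia.
have big : \sum_(z in A) delta ^ 2 * kappa <= \sum_(z in A)
   (kappa * #|tnbr i1 i2 F [set z] :\: tnbr i1 i2 F (Om :\ z)| + 7 * delta ^ 2).
  exact: leq_sum.
rewrite big_split -[X in _ <= X + _]big_distrr !sum_nat_const cA /= in big.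
rewrite -mulnA (leq_trans big) // [7 * (p * _)]mulnCA leq_add2r.
by rewrite leq_mul2l (sum_private_leq _ _ _ AO) orbT.
Qed.

End GoodDraws.

(** * Numerical inequalities for the parameters *)

Lemma natr_expR_le (R : realType) (n : nat) : expR n%:R <= 4 ^+ n :> R.
Proof.
(* Inverse of [1 - 1/2 <= expR (- 1/2)]; squaring it bounds [expR 1] by 4. *)
have half : expR (2^-1) <= 2 :> R.
  rewrite -[leLHS]invrK -expRN -[leRHS]invrK lef_pV2 ?posrE ?invr_gt0 ?expR_gt0 //.
  by apply: le_trans (expR_ge1Dx _); lra.
have one : expR 1 <= 4 :> R.
  have -> : expR 1 = expR 2^-1 * expR 2^-1 :> R by rewrite -expRD; congr expR; lra.
  by rewrite (_ : 4 = 2 * 2 :> R) ?ler_pM ?expR_ge0 // -natrM.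
elim: n => [|n IHn]; first by rewrite expR0 expr0.
by rewrite -natr1 expRD exprSr ler_pM ?expR_ge0.
Qed.

(* C1 = 5 gives 4 ^ delta >= p ^ 5, against O(delta p^2) bad events of probability
   at most 4 ^ - delta each; C2 = 6 * 8 ^ kappa makes each target set have density
   at most 8 ^ - kappa, as delta < 6 ln p. *)
Lemma draw_parameters (R : realType) (kappa d : nat) : (0 < kappa)%N -> (0 < d)%N ->
  exists p0 : nat, forall p : nat, (p0 <= p)%N -> forall delta m : nat,
    delta%:Z = Num.ceil (5 * ln (p%:R : R)) ->
    m%:Z = Num.ceil (6 * 8 ^+ kappa * Num.sqrt (d%:R * p%:R) * ln (p%:R : R)) ->
    [/\ (0 < p)%N && (0 < m)%N, (kappa <= delta)%N, (d.+1 * delta * 8 ^ kappa <= m)%N,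
        (d * p * delta ^ 2 * 8 ^ kappa <= m ^ 2)%N
      & ((2 * p + 2 * p ^ 2 + 2 * delta * p ^ 2) * p < 4 ^ delta)%N].
Proof.
move=> k0 d0.
(* The three terms serve, in order, the final polynomial inequality, [d.+1 <= sqrt (d p)], and
   [kappa <= ln p]. *)
exists (17 + d.+1 ^ 2 + Num.bound (expR kappa%:R : R))%N => p hp delta m hdelta hm.
have p17 : (17 <= p)%N by lia.
have pd : (d.+1 ^ 2 <= p)%N by lia.
have pe : expR kappa%:R <= p%:R :> R.
  apply: ltW (lt_le_trans (archi_boundP (expR_ge0 _)) _).
  by rewrite ler_nat; lia.
have p0 : 0 < p%:R :> R by rewrite ltr0n; lia.
pose l : R := ln p%:R.
have pl : p%:R = expR l by rewrite lnK ?posrE.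
have lk : kappa%:R <= l by rewrite -ler_expR -pl.
have l1 : 1 <= l by apply: le_trans lk; rewrite ler1n.
have dl : 5 * l <= delta%:R < 6 * l.
  have := ceil_itv (5 * l); rewrite -hdelta intrB -pmulrn => /andP[h1 h2].
  by apply/andP; split; lra.
have ml : 6 * 8 ^+ kappa * Num.sqrt (d%:R * p%:R) * l <= m%:R.
  by have := ceil_ge (6 * 8 ^+ kappa * Num.sqrt (d%:R * p%:R) * l); rewrite -hm -pmulrn.
have /andP[dl1 dl2] := dl.
move: ml; set s := Num.sqrt _ => ml.
have s2 : s ^+ 2 = d%:R * p%:R by rewrite sqr_sqrtr // mulr_ge0 // ler0n.
have sge : d.+1%:R <= s.
  rewrite -(@ler_pXn2r _ 2) ?nnegrE ?sqrtr_ge0 // s2 -natrX -natrM ler_nat.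
  by rewrite (leq_trans pd) // leq_pmull.
have s1 : 1 <= s by apply: le_trans sge; rewrite ler1n.
have Q1 : 1 <= 8 ^+ kappa :> R by rewrite exprn_ege1 // ler1n.
move: Q1 ml; set Q : R := 8 ^+ kappa => Q1 ml.
have QE : (8 ^ kappa)%N%:R = Q by rewrite natrX.
have d1 : 0 <= delta%:R :> R by rewrite ler0n.
split.
- apply/andP; split; first by lia.
  rewrite -(ltr_nat R); apply: lt_le_trans ml; rewrite !mulr_gt0 //; lra.
- by rewrite -(ler_nat R); lra.
- rewrite -(ler_nat R) !natrM QE; apply: le_trans ml.
  have -> : 6 * Q * s * l = s * (6 * l) * Q by ring.
  rewrite ler_wpM2r ?ler_pM ?ler0n //; lra.
- have E : (d * p * delta ^ 2 * 8 ^ kappa)%N%:R = s ^+ 2 * delta%:R ^+ 2 * Q.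
    by rewrite -QE s2 -!natrX -!natrM.
  rewrite -(ler_nat R) E natrX.
  have ml0 : 0 <= 6 * Q * s * l by rewrite !mulr_ge0 //; lra.
  apply: le_trans (_ : (6 * Q * s * l) ^+ 2 <= _); last first.
    by rewrite ler_pXn2r // nnegrE ?ler0n.
  have -> : (6 * Q * s * l) ^+ 2 = s ^+ 2 * (6 * l) ^+ 2 * (Q * Q) by ring.
  have [Q0 s0] : 0 <= Q /\ 0 <= s by split; lra.
  rewrite ler_pM ?mulr_ge0 ?sqr_ge0 //.
    by rewrite ler_wpM2l ?sqr_ge0 // ler_pXn2r ?nnegrE //; lra.
  by rewrite ler_peMl //; lra.
- rewrite -(ltr_nat R) natrX; apply: lt_le_trans (natr_expR_le R delta).
  have : p%:R ^+ 5 <= expR delta%:R :> R.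
    by rewrite pl -expRM_natl ler_expR.
  apply: lt_le_trans.
  have lp : l <= p%:R by rewrite pl; apply: le_trans (expR_ge1Dx _); lra.
  have P17 : 17 <= p%:R :> R by rewrite ler_nat.
  have -> : ((2 * p + 2 * p ^ 2 + 2 * delta * p ^ 2) * p)%N%:R =
      2 * p%:R ^+ 2 + 2 * p%:R ^+ 3 + 2 * (delta%:R * p%:R ^+ 3) :> R by ring.
  move: (p%:R : R) p0 P17 lp => P P0 P17 lp.
  have hX n : 0 <= P ^+ n by rewrite exprn_ge0 // ltW.
  have h n : 17 * P ^+ n <= P ^+ n.+1 by rewrite exprS ler_wpM2r.
  (* The crude bound [ln p <= p] is enough: the main term is [12 * P ^+ 4], below [P ^+ 5] with room
     for the lower powers once [P >= 17]. *)
  have hd : delta%:R * P ^+ 3 <= 6 * P ^+ 4.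
    by rewrite [P ^+ 4]exprS mulrA ler_wpM2r //; lra.
  have := h 4; have := h 3; have := h 2; have : 0 < P ^+ 2 by rewrite exprn_gt0.
  lra.
Qed.

(** * The three properties for good draws, and their probability in both models *)

Lemma good_draws_tensor (R : realType) (L : finType) (p delta m kappa : nat)
    (i1 i2 : 'I_p -> L) (Om : {set 'I_p * 'I_p})
    (F : {ffun L * 'I_delta -> 'I_m}) :
  injective i1 -> injective i2 -> (0 < kappa <= delta)%N ->
  (forall i, (i, i) \in Om) -> good_draws kappa i1 i2 Om F ->
  good_tensor (7 / kappa%:R : R) delta Om (graph_of (rows i1 F)) (graph_of (rows i2 F)).
Proof.
move=> inj1 inj2 /andP[k0 kd] dOm good.
have K0 : 0 < kappa%:R :> R by rewrite ltr0n.
have overlap z : #|tnbr i1 i2 F [set z] :&: tnbr i1 i2 F (Om :\ z)|%:R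
    <= 7 / kappa%:R * delta%:R ^+ 2 :> R.
  rewrite mulrAC ler_pdivlMr // mulrC -natrX -!natrM ler_nat.
  apply: leq_trans (good_overlap inj1 inj2 z kd good) _.
  by rewrite leq_mul2r orbT.
apply/and3P; split.
- have := good_expansion inj1 inj2 kd dOm good.
  rewrite -(ler_nat R) natrD !natrM -!expr2 => H.
  rewrite -(ler_pM2r K0); apply: le_trans (_ : p%:R * delta%:R ^+ 2 * kappa%:R -
     7 * (p%:R * delta%:R ^+ 2) <= _).
    by rewrite le_eqVlt; apply/orP; left; apply/eqP; field; rewrite gt_eqF.
  by rewrite lerBlDr (le_trans H) // [kappa%:R * _]mulrC.
(* Outside [Om], removing [z] changes nothing, so this is the same overlap bound. *)
- apply/forall_inP => z; rewrite inE => zO; have := overlap z.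
  rewrite (_ : Om :\ z = Om) //; apply/setP => u; rewrite !inE.
  by case: eqP => // ->; apply/esym/negbTE.
- by apply/forall_inP => z _; apply: overlap.
Qed.

Lemma left_regular_lawE (R : realType) (p delta m : nat) (j : choices p delta m) :
  left_regular_law R j = #|{: choices p delta m}|%:R^-1.
Proof.
rewrite /left_regular_law /uniform_law !card_ffun !card_ord !natrX.
by rewrite !prodr_const !card_ord -!exprVn.
Qed.

(** By equality of cardinals the injection [phi] carries the uniform law on [T] to that on [S], so
    the count of bad tables bounds the probability of failure by [b / q]. *)
Lemma Pr_uniform_ge (R : realType) (T S : finType) (mu : T -> R) (phi : T -> S)
    (A : pred T) (G : pred S) (b q : nat) :
  (forall w, mu w = #|T|%:R^-1) -> injective phi -> #|T| = #|S| -> (0 < #|T|)%N ->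
  (forall w, G (phi w) -> A w) -> (0 < q)%N ->
  (q * #|[set F | ~~ G F]| <= b * #|S|)%N ->
  1 - b%:R / q%:R <= Pr mu A.
Proof.
move=> muE inj cTS T0 GA q0 bad.
have T0' : 0 < #|T|%:R :> R by rewrite ltr0n.
have Q0 : 0 < q%:R :> R by rewrite ltr0n.
have -> : Pr mu A = #|A|%:R / #|T|%:R.
  by rewrite /Pr (eq_bigr _ (fun w _ => muE w)) sumr_const -[LHS]mulr_natl.
have cA : (#|predC A| <= #|[set F | ~~ G F]|)%N.
  rewrite -(card_imset _ inj); apply/subset_leq_card/subsetP => _ /imsetP[w wA ->].
  by rewrite inE; apply: contra wA; apply: GA.
have : (q * #|predC A| <= b * #|T|)%N.
  by rewrite cTS; apply: leq_trans bad; rewrite leq_mul2l cA orbT.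
rewrite -(ler_nat R) !natrM => H.
rewrite ler_pdivlMr // mulrBl mul1r lerBlDr -{1}(cardC A) natrD lerD2l.
rewrite mulrAC ler_pdivlMr //.
by rewrite mulrC.
Qed.

(** Two independent families of draws form a single table over the disjoint union of the left
    sides. *)
Definition draws_of_pair (p delta m : nat) (w : choices p delta m * choices p delta m) :
    {ffun ('I_p + 'I_p) * 'I_delta -> 'I_m} :=
  [ffun z => match z.1 with inl i => w.1 i z.2 | inr i => w.2 i z.2 end].

Definition draws_of (p delta m : nat) (j : choices p delta m) :
    {ffun 'I_p * 'I_delta -> 'I_m} := [ffun z => j z.1 z.2].

Lemma rows_inl (p delta m : nat) (w : choices p delta m * choices p delta m) :
  rows inl (draws_of_pair w) = w.1.
Proof. by apply/ffunP => i; apply/ffunP => k; rewrite !ffunE. Qed.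

Lemma rows_inr (p delta m : nat) (w : choices p delta m * choices p delta m) :
  rows inr (draws_of_pair w) = w.2.
Proof. by apply/ffunP => i; apply/ffunP => k; rewrite !ffunE. Qed.

Lemma rows_id (p delta m : nat) (j : choices p delta m) : rows id (draws_of j) = j.
Proof. by apply/ffunP => i; apply/ffunP => k; rewrite !ffunE. Qed.

Theorem lemma1 (R : realType) :
  exists C1 C2 c eps : R,
    [/\ 0 < C1, 0 < C2, 0 < c & 0 < eps < 1 / 4] /\
    forall d : nat, (1 <= d)%N ->
    exists p0 : nat, forall p : nat, (p0 <= p)%N ->
    forall delta m : nat,
      delta%:Z = Num.ceil (C1 * ln (p%:R : R)) ->
      m%:Z = Num.ceil (C2 * Num.sqrt (d%:R * p%:R) * ln (p%:R : R)) ->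
    forall Omega : {set 'I_p * 'I_p}, distributed d Omega ->
      (* G1 and G2 independent *)
      1 - p%:R `^ (- c) <
        Pr (indep_law (@left_regular_law R p delta m)
                      (@left_regular_law R p delta m))
           (fun w => good_tensor eps delta Omega
                       (graph_of w.1) (graph_of w.2)) /\
      (* G2 = G1 *)
      1 - p%:R `^ (- c) <
        Pr (@left_regular_law R p delta m)
           (fun j => good_tensor eps delta Omega
                       (graph_of j) (graph_of j)).
Proof.
(* Only [7 / kappa < 1 / 4] matters; the existential keeps [kappa] symbolic. *)
have [kappa k28] : exists kappa : nat, (28 < kappa)%N by exists 29%N.
have k0 : (0 < kappa)%N by apply: leq_trans k28.
have K0 : 0 < kappa%:R :> R by rewrite ltr0n.
exists 5, (6 * 8 ^+ kappa), 1, (7 / kappa%:R); split.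
  have K29 : 28 < kappa%:R :> R by rewrite ltr_nat.
  split=> //; first by rewrite mulr_gt0 ?exprn_gt0.
  by rewrite divr_gt0 //= ltr_pdivrMr //; lra.
move=> d d0; have [p0 Hp0] := draw_parameters R k0 d0.
exists p0 => p pp0 delta m hdelta hm Om HO.
have [/andP[p_gt0 m0] kd dm dpm small] := Hp0 p pp0 delta m hdelta hm.
have delta0 : (0 < delta)%N by apply: leq_trans kd.
have q0 : (0 < 4 ^ delta)%N by rewrite expn_gt0.
(* The spare factor [p] in [small] puts the failure probability below [1 / p], hence [c = 1]. The
   term [2 * p] covers [#|L|] in both models. *)
have lt (b : nat) : (b <= 2 * p + 2 * p ^ 2 + 2 * delta * p ^ 2)%N ->
    1 - p%:R `^ (- 1) < 1 - b%:R / (4 ^ delta)%N%:R :> R.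
  move=> bb; have bp := leq_ltn_trans (leq_mul bb (leqnn p)) small.
  rewrite powR_inv1 ?ler0n // ltrD2l ltrN2 ltr_pdivrMr ?ltr0n //.
  by rewrite ltr_pdivlMl ?ltr0n // -natrM ltr_nat mulnC.
have ch0 : (0 < #|{: choices p delta m}|)%N.
  by rewrite !card_ffun !card_ord !expn_gt0 m0.
split.
- have bad := @card_not_good_draws ('I_p + 'I_p)%type p delta m kappa inl inr
    d Om HO m0 delta0 dm dpm.
  apply: (lt_le_trans (lt _ _)
    (Pr_uniform_ge (phi := @draws_of_pair p delta m) _ _ _ _ _ q0 bad)).
  + by rewrite card_sum card_ord; lia.
  + by move=> w; rewrite /indep_law !left_regular_lawE card_prod natrM invfM.
  + move=> w w' E; rewrite [w]surjective_pairing [w']surjective_pairing.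
    by rewrite -!rows_inl -!rows_inr E.
  + rewrite card_prod !card_ffun card_prod card_sum !card_ord -expnM -expnD.
    by congr (_ ^ _)%N; lia.
  + by rewrite card_prod muln_gt0 ch0.
  + move=> w; have [dO _] := HO => good.
    rewrite -(rows_inl w) -(rows_inr w).
    by apply: (good_draws_tensor R inl_inj inr_inj _ dO good); rewrite k0.
- have bad := @card_not_good_draws 'I_p p delta m kappa id id d Om HO m0 delta0 dm dpm.
  apply: (lt_le_trans (lt _ _)
    (Pr_uniform_ge (phi := @draws_of p delta m) _ _ _ _ _ q0 bad)).
  + by rewrite card_ord; lia.
  + by move=> w; rewrite left_regular_lawE.
  + by move=> w w' E; rewrite -[w]rows_id E rows_id.
  + by rewrite !card_ffun card_prod !card_ord -expnM mulnC.
  + by [].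
  + move=> w; have [dO _] := HO => good.
    rewrite -(rows_id w).
    by apply: good_draws_tensor dO good; rewrite ?k0 //; apply: inj_id.
Qed.
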